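(* Suppose that $\mu,\nu\in\mathbb{R}$, $p\in(0,1)$, and $(\widetilde Y_m)_{m\in\mathbb{N}}$ is an i.i.d. sequence of $\{\mu,\nu\}$-valued random variables with $\mathbb{P}[\widetilde Y_m=\nu]=p$. For $\gamma\in(-1,1)$, let $\widetilde Z$ be the random variable $$\widetilde Z=\sum_{m=1}^\infty\gamma^m\widetilde Y_m.$$ Then, for $k\in\mathbb{N}$, the $k^{\text{th}}$ moment of $\widetilde Z$ is given by the recursive formula $$\mathbb{E}[\widetilde Z^k]=\frac{\gamma^k}{1-\gamma^k}\sum_{j=0}^{k-1}\binom{k}{j}\Big(p\,\nu^{k-j}+(1-p)\mu^{k-j}\Big)\mathbb{E}[\widetilde Z^j].$$
   Context: $\mathbb{N}=\{1,2,\dots\}$; $\mathbb{E}[\widetilde Z^0]=1$. *)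

(* Defs.v *)
From HB Require Import structures.
From mathcomp Require Import all_boot all_order all_algebra finmap.
From mathcomp Require Import all_classical all_reals all_analysis.
Import Order.TTheory GRing.Theory Num.Theory.
Import numFieldNormedType.Exports.

Set Implicit Arguments.
Unset Strict Implicit.
Unset Printing Implicit Defensive.

Local Open Scope classical_set_scope.
Local Open Scope ring_scope.

Section iid.
Context {d : measure_display} {T : measurableType d} {R : realType}.
Variable P : probability T R.

(* Mutual independence of the family (X i), i \in I: the product rule for all
   finite subfamilies. *)
Definition independent_RVs (K : choiceType) (I : set K)
    (X : K -> {RV P >-> R}) : Prop :=
  forall (J : {fset K}) (B : K -> set R),
    [set` J] `<=` I ->
    (forall i, i \in J -> measurable (B i)) ->
    P (\bigcap_(i in [set` J]) X i @^-1` B i) =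
    (\prod_(i <- J) P (X i @^-1` B i))%E.

(* The laws are only compared on Borel sets: the value of [distribution] on a
   non-measurable set is not meaningful. *)
Definition identically_distributed (K : Type) (I : set K)
    (X : K -> {RV P >-> R}) : Prop :=
  forall i j, I i -> I j ->
    forall B : set R, measurable B ->
      distribution P (X i) B = distribution P (X j) B.

Definition iid (K : choiceType) (I : set K) (X : K -> {RV P >-> R}) : Prop :=
  independent_RVs I X /\ identically_distributed I X.

(* The term [Y 0] is never used: sequences are indexed by m = 1, 2, ... *)
Definition discounted_sum (gamma : R) (Y : nat -> {RV P >-> R}) (w : T) : R :=
  \big[+%R/0]_(1 <= m <oo) (gamma ^+ m * Y m w).

End iid.

(* Main.v *)
Require Import Defs.
From HB Require Import structures.
From mathcomp Require Import all_boot all_order all_algebra finmap.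
From mathcomp Require Import all_classical all_reals all_analysis.
From mathcomp Require Import measurable_realfun ring.
Import Order.TTheory GRing.Theory Num.Theory.
Import numFieldNormedType.Exports.

Local Open Scope classical_set_scope.
Local Open Scope ring_scope.

(** Write [S_n] for the partial sum of order [n] and [S'_n] for the same sum
    built on the shifted sequence. Then [S_(n+1) = gamma (Y_1 + S'_n)], where
    [S'_n] is independent of [Y_1] and has the law of [S_n]; expanding the [k]-th
    power gives the moments of [S_(n+1)] from those of [S_n]. The partial sums
    are bounded uniformly in [n] and in the sample point, so by dominated
    convergence the relation passes to the limit; solving it for the [k]-th
    moment divides by [1 - gamma ^ k]. *)

(** * Moment recursion for the iterated two-point average *)

Section moments.
Set Implicit Arguments.
Unset Strict Implicit.
Context {R : realType} (mu nu p gamma : R).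

(* [iter_mean n f] is the expectation of [f (S_n)], obtained by conditioning on
   [Y_1], then [Y_2], and so on. *)
Fixpoint iter_mean (n : nat) (f : R -> R) : R :=
  if n is m.+1 then
    p * iter_mean m (fun x => f (gamma * (nu + x))) +
    (1 - p) * iter_mean m (fun x => f (gamma * (mu + x)))
  else f 0.

Lemma iter_mean_sum (n K : nat) (c : nat -> R) (f : nat -> R -> R) :
  iter_mean n (fun x => \sum_(i < K) c i * f i x) =
  \sum_(i < K) c i * iter_mean n (f i).
Proof.
elim: n f => [//|n IHn] f /=.
rewrite (IHn (fun i x => f i (gamma * (nu + x)))).
rewrite (IHn (fun i x => f i (gamma * (mu + x)))).
rewrite !mulr_sumr -big_split /=; apply: eq_bigr => i _.
by rewrite mulrDr !(mulrCA _ (c i)).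
Qed.

(** Binomial expansion of [(gamma * (a + x)) ^+ k] for [a = nu] and [a = mu], followed by linearity.
    The term [j = k] stays in the sum: in the limit it puts the unknown moment on both sides. *)
Lemma iter_mean_exp (n k : nat) :
  iter_mean n.+1 (fun x => x ^+ k) =
  gamma ^+ k * \sum_(j < k.+1)
    'C(k, j)%:R * (p * nu ^+ (k - j) + (1 - p) * mu ^+ (k - j)) *
      iter_mean n (fun x => x ^+ j).
Proof.
have expand (a : R) :
    iter_mean n (fun x => (gamma * (a + x)) ^+ k) =
    \sum_(j < k.+1) (gamma ^+ k * 'C(k, j)%:R * a ^+ (k - j)) *
      iter_mean n (fun x => x ^+ j).
  rewrite -(iter_mean_sum n k.+1
    (fun j => gamma ^+ k * 'C(k, j)%:R * a ^+ (k - j)) (fun j x => x ^+ j)).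
  congr iter_mean; apply/funext => x.
  rewrite exprMn exprDn mulr_sumr; apply: eq_bigr => j _.
  by rewrite -mulr_natr; ring.
rewrite /= !expand !mulr_sumr -big_split /=; apply: eq_bigr => j _; ring.
Qed.

End moments.

(** * Expectations of functions of the partial sums *)

Section coin.
Set Implicit Arguments.
Unset Strict Implicit.
Context {d : measure_display} {T : measurableType d} {R : realType}.
Context (P : probability T R) (mu nu p gamma : R) (Y : nat -> {RV P >-> R}).
Context (p_lt1 : p < 1).
Context (Y_indep : independent_RVs [set m : nat | (1 <= m)%N] Y).
Context (Y_val :
  forall m : nat, (1 <= m)%N -> forall w : T, [set mu; nu] (Y m w)).
Context (Y_nu : forall m : nat, (1 <= m)%N -> P (Y m @^-1` [set nu]) = p%:E).

Let measurable_Y (m : nat) (B : set R) :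
  measurable B -> measurable (Y m @^-1` B).
Proof. by move=> mB; rewrite -[X in measurable X]setTI; exact: measurable_funP. Qed.

(** Were the two values equal, [Y 1] would be constantly [nu], which forces [p = 1]. *)
Lemma coin_neq : mu != nu.
Proof.
apply/eqP => munu; have := Y_nu (leqnn 1).
rewrite (_ : _ @^-1` _ = setT); last first.
  apply/seteqP; split=> // w _ /=.
  by case: (Y_val (leqnn 1) w) => ->.
by rewrite probability_setT => -[p1]; move: p_lt1; rewrite -p1 ltxx.
Qed.

Lemma coin_mu_setC (m : nat) : (1 <= m)%N ->
  Y m @^-1` [set mu] = ~` (Y m @^-1` [set nu]).
Proof.
move=> m1; apply/seteqP; split=> w /=.
  by move=> -> munu; move/eqP: coin_neq.
by case: (Y_val m1 w).
Qed.

Lemma coin_mu (m : nat) : (1 <= m)%N -> P (Y m @^-1` [set mu]) = (1 - p)%:E.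
Proof.
move=> m1; rewrite coin_mu_setC// probability_setC; first by rewrite Y_nu.
exact: (measurable_Y m (measurable_set1 nu)).
Qed.

(** The weights restart at [gamma] whatever the shift [s], so that removing the first variable
    leaves a sum of the same form with shift [s + 1]. *)
Definition tail_sum (s n : nat) (w : T) : R :=
  \sum_(i < n) gamma ^+ i.+1 * Y (s + i).+1 w.

Lemma tail_sumS (s n : nat) (w : T) :
  tail_sum s n.+1 w = gamma * (Y s.+1 w + tail_sum s.+1 n w).
Proof.
rewrite /tail_sum big_ord_recl addn0 expr1 mulrDr mulr_sumr; congr (_ + _).
by apply: eq_bigr => i _; rewrite lift0 addnS addSn exprS mulrA.
Qed.

Lemma measurable_tail_sum (s n : nat) : measurable_fun setT (tail_sum s n).
Proof.
apply: measurable_sum => i; apply: measurable_funM => //.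
Qed.

(** The index [s + 1] lies outside [J], so its constraint can be written into [B] without touching
    the others, and the product rule splits off the factor [q]. *)
Lemma independent_cylinderI (J : {fset nat}) (B : nat -> set R) (s : nat)
    (a q : R) :
  (forall i, i \in J -> (1 <= i <= s)%N) -> (forall i, measurable (B i)) ->
  P (Y s.+1 @^-1` [set a]) = q%:E ->
  exists B' : nat -> set R,
    [/\ forall i, measurable (B' i),
        \bigcap_(i in [set` (s.+1 |` J)%fset]) Y i @^-1` B' i =
          Y s.+1 @^-1` [set a] `&` \bigcap_(i in [set` J]) Y i @^-1` B i &
        P (\bigcap_(i in [set` (s.+1 |` J)%fset]) Y i @^-1` B' i) =
          (q%:E * P (\bigcap_(i in [set` J]) Y i @^-1` B i))%E].
Proof.
move=> Js mB Pa.
have sJ : s.+1 \notin J by apply/negP => /Js; rewrite ltnn andbF.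
pose B' i := if i == s.+1 then [set a] else B i.
have mB' i : measurable (B' i) by rewrite /B'; case: ifP.
have B'J : \bigcap_(i in [set` J]) Y i @^-1` B' i =
           \bigcap_(i in [set` J]) Y i @^-1` B i.
  apply: eq_bigcapr => i /= iJ; rewrite /B' ifF//.
  by apply: contraNF sJ => /eqP <-.
exists B'; split=> //.
  by rewrite bigcap_fsetU1 B'J /B' eqxx.
(* The product rule is used twice: forwards on the enlarged index set, then backwards on [J] to
   reassemble the old cylinder. *)
rewrite Y_indep//; last first.
  by move=> i /=; rewrite 2!inE => /orP[/eqP ->|/Js/andP[]].
rewrite big_fsetU1//= {1}/B' eqxx Pa; congr (_ * _)%E.
by rewrite -B'J Y_indep// => i /= /Js /andP[].
Qed.

(* Integrating over an arbitrary cylinder on the coordinates up to [s] is what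
   lets the induction condition on [Y (s + 1)]: the new constraint is absorbed
   into the cylinder. *)
Lemma integral_cylinder_tail_sum (n s : nat) (f : R -> R) (J : {fset nat})
    (B : nat -> set R) :
  measurable_fun setT f -> (forall i, i \in J -> (1 <= i <= s)%N) ->
  (forall i, measurable (B i)) ->
  (\int[P]_(w in \bigcap_(i in [set` J]) Y i @^-1` B i) (f (tail_sum s n w))%:E =
   (iter_mean mu nu p gamma n f)%:E *
     P (\bigcap_(i in [set` J]) Y i @^-1` B i))%E.
Proof.
elim: n s f J B => [|n IHn] s f J B mf Js mB.
  rewrite -(integral_cst P); last first.
    apply: fin_bigcap_measurable; [exact: finite_fset|].
    by move=> i _; exact: measurable_Y.
  by apply: eq_integral => w _; rewrite /tail_sum big_ord0.
have [Bnu [mBnu Anu Pnu]] :=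
  independent_cylinderI Js mB (Y_nu (ltn0Sn s)).
have [Bmu [mBmu Amu Pmu]] :=
  independent_cylinderI Js mB (coin_mu (ltn0Sn s)).
have mA (K : {fset nat}) C : (forall i, measurable (C i)) ->
    measurable (\bigcap_(i in [set` K]) Y i @^-1` C i).
  move=> mC; apply: fin_bigcap_measurable; [exact: finite_fset|].
  by move=> i _; exact: measurable_Y.
have JsS i : i \in (s.+1 |` J)%fset -> (1 <= i <= s.+1)%N.
  rewrite inE => /orP[|/Js/andP[-> /leqW]//].
  by rewrite inE => /eqP ->; rewrite leqnn.
have maff (a : R) : measurable_fun setT (fun x => f (gamma * (a + x))).
  apply: (measurableT_comp mf); apply: measurable_funM => //.
  exact: measurable_funD.
have step a (C : nat -> set R) : (forall i, measurable (C i)) ->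
    \bigcap_(i in [set` (s.+1 |` J)%fset]) Y i @^-1` C i =
      Y s.+1 @^-1` [set a] `&` \bigcap_(i in [set` J]) Y i @^-1` B i ->
    (\int[P]_(w in \bigcap_(i in [set` (s.+1 |` J)%fset]) Y i @^-1` C i)
       (f (tail_sum s n.+1 w))%:E =
     (iter_mean mu nu p gamma n (fun x => f (gamma * (a + x))))%:E *
     P (\bigcap_(i in [set` (s.+1 |` J)%fset]) Y i @^-1` C i))%E.
  move=> mC AC; rewrite -(IHn s.+1)//.
  by apply: eq_integral => w; rewrite AC inE => -[/= Ya _]; rewrite tail_sumS Ya.
(* The cylinder is split by the value of [Y (s + 1)]; on each piece that variable is constant and
   [step] applies. *)
have AE : \bigcap_(i in [set` J]) Y i @^-1` B i =
    \bigcap_(i in [set` (s.+1 |` J)%fset]) Y i @^-1` Bnu i `|`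
    \bigcap_(i in [set` (s.+1 |` J)%fset]) Y i @^-1` Bmu i.
  by rewrite Anu Amu -setIUl (coin_mu_setC (ltn0Sn s)) setUv setTI.
have disj : \bigcap_(i in [set` (s.+1 |` J)%fset]) Y i @^-1` Bnu i `&`
    \bigcap_(i in [set` (s.+1 |` J)%fset]) Y i @^-1` Bmu i = set0.
  rewrite Anu Amu (coin_mu_setC (ltn0Sn s)) -subset0 => w.
  by move=> [[? _] []].
rewrite {1}AE integral_setU//; [|exact: mA|exact: mA| |exact/eqP]; last first.
  apply: measurable_funTS; apply/measurable_EFinP.
  exact: (measurableT_comp mf (measurable_tail_sum _ _)).
rewrite (step nu)// (step mu)// Pnu Pmu.
have [r ->] : exists r, P (\bigcap_(i in [set` J]) Y i @^-1` B i) = r%:E.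
  exists (fine (P (\bigcap_(i in [set` J]) Y i @^-1` B i))); rewrite fineK//.
  exact/fin_num_measure/mA.
by rewrite /= -!EFinM -EFinD; congr EFin; ring.
Qed.

(** With no coordinate constrained, the cylinder is the whole space. *)
Lemma expectation_tail_sum (n : nat) (f : R -> R) : measurable_fun setT f ->
  (\int[P]_w (f (tail_sum 0 n w))%:E = (iter_mean mu nu p gamma n f)%:E)%E.
Proof.
move=> mf; have := @integral_cylinder_tail_sum n 0 f fset0 (fun=> setT) mf.
rewrite set_fset0 bigcap_set0 probability_setT mule1; apply => //.
Qed.

Lemma discounted_sum_partialE (n : nat) (w : T) :
  \sum_(1 <= m < n.+1) gamma ^+ m * Y m w = tail_sum 0 n w.
Proof. by rewrite big_add1 big_mkord. Qed.

(** * Convergence of the series and of its moments *)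

Context (gamma_bound : `|gamma| < 1).

Lemma norm_coin_le (m : nat) (w : T) : (1 <= m)%N -> `|Y m w| <= `|mu| + `|nu|.
Proof. by move=> /Y_val/(_ w)[] ->; rewrite ?lerDl ?lerDr. Qed.

Lemma norm_tail_sum_le (s n : nat) (w : T) :
  `|tail_sum s n w| <= (`|mu| + `|nu|) / (1 - `|gamma|).
Proof.
have g1 : 0 < 1 - `|gamma| by rewrite subr_gt0.
have munu : 0 <= `|mu| + `|nu| by rewrite addr_ge0.
set b := _ / _; have b0 : 0 <= b by rewrite divr_ge0 ?(ltW g1).
have bE : `|mu| + `|nu| = b * (1 - `|gamma|) by rewrite divfK// gt_eqF.
elim: n s => [|n IHn] s.
  by rewrite /tail_sum big_ord0 normr0.
rewrite tail_sumS normrM.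
apply: (@le_trans _ _ (`|gamma| * (b * (1 - `|gamma|) + b))).
  apply: ler_wpM2l => //; apply: le_trans (ler_normD _ _) _.
  by rewrite -bE lerD ?IHn ?norm_coin_le.
(* The bound [b] reproduces itself under the recursion, with slack [b * (1 - |gamma|) ^+ 2]. *)
rewrite -subr_ge0 (_ : _ - _ = b * (1 - `|gamma|) ^+ 2); last by ring.
by rewrite mulr_ge0 ?sqr_ge0.
Qed.

Lemma is_cvg_tail_sum (w : T) : cvgn (fun n => tail_sum 0 n w).
Proof.
rewrite (_ : (fun n => _) = series (fun i => gamma ^+ i.+1 * Y i.+1 w)); last first.
  by apply/funext => n; rewrite /series /= big_mkord.
apply: normed_cvg.
apply: (@series_le_cvg _ _ (geometric (`|mu| + `|nu|) `|gamma|)) => //.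
- by move=> n; exact: normr_ge0.
- by move=> n; apply: geometric_ge0; rewrite ?addr_ge0.
- move=> n /=; rewrite normrM normrX mulrC ler_pM ?norm_coin_le//.
  by rewrite exprS ler_piMl ?exprn_ge0// ltW.
- by apply: is_cvg_geometric_series; rewrite normr_id.
Qed.

Lemma cvg_discounted_partial (w : T) :
  (fun n : nat => \sum_(1 <= m < n) gamma ^+ m * Y m w) @ \oo -->
  limn (fun n => tail_sum 0 n w).
Proof.
(* The sum over [1 <= m < n] has [n - 1] terms, hence the shift by one. *)
rewrite -cvg_shiftS (_ : [sequence _]_n = (fun n => tail_sum 0 n w)); last first.
  by apply/funext => n; exact: discounted_sum_partialE.
exact: is_cvg_tail_sum.
Qed.

Lemma cvg_tail_sum (w : T) :
  tail_sum 0 n w @[n --> \oo] --> discounted_sum gamma Y w.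
Proof.
rewrite /discounted_sum (cvg_lim _ (@cvg_discounted_partial w))//.
exact: is_cvg_tail_sum.
Qed.

Lemma discounted_sum_moment (k : nat) :
  P.-integrable setT (fun w => (discounted_sum gamma Y w ^+ k)%:E) /\
  iter_mean mu nu p gamma n (fun x => x ^+ k) @[n --> \oo] -->
    fine ('E_P[fun w => (discounted_sum gamma Y w ^+ k)%R])%E.
Proof.
pose Z := discounted_sum gamma Y.
have mS n : measurable_fun setT (fun w => tail_sum 0 n w ^+ k).
  exact/measurable_funX/measurable_tail_sum.
have cvgS w : (tail_sum 0 n w ^+ k) @[n --> \oo] --> Z w ^+ k.
  exact: (@continuous_cvg _ _ _ _ _ _ (fun x : R => x ^+ k) _
    (@exprn_continuous _ k _) (@cvg_tail_sum w)).
(* The dominating constant is the [k]-th power of the uniform bound on the partial sums; it is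
   integrable since [P] is finite. *)
have [] := @dominated_convergence _ _ _ P setT measurableT
  (fun n w => (tail_sum 0 n w ^+ k)%:E) (fun w => (Z w ^+ k)%:E)
  (EFin \o cst (((`|mu| + `|nu|) / (1 - `|gamma|)) ^+ k)).
- by move=> n; exact/measurable_EFinP.
- by apply/measurable_EFinP; apply: (measurable_fun_cvg mS) => w _; exact: cvgS.
- by apply: aeW => w _; apply: cvg_EFin; [exact: nearW|exact: cvgS].
- exact: finite_measure_integrable_cst.
- apply: aeW => w n _; rewrite /= lee_fin normrX.
  have Sb := norm_tail_sum_le 0 n w.
  by rewrite lerXn2r ?nnegrE// (le_trans _ Sb).
move=> iZ _ cvgI; split=> //.
apply: (@fine_cvg _ _ _ _
  (fun n => (iter_mean mu nu p gamma n (fun x => x ^+ k))%:E)).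
rewrite unlock fineK; last exact: integrable_fin_num.
apply: cvg_trans cvgI; apply: near_eq_cvg; apply: nearW => n /=.
by rewrite (@expectation_tail_sum n (fun x => x ^+ k))//; exact: measurable_funX.
Qed.

End coin.

Theorem lemma3p5 (d : measure_display) (T : measurableType d) (R : realType)
    (P : probability T R) (mu nu p : R) (p_gt0 : 0 < p) (p_lt1 : p < 1)
    (Y : nat -> {RV P >-> R})
    (Y_iid : iid [set m : nat | (1 <= m)%N] Y)
    (Y_val : forall m : nat, (1 <= m)%N -> forall w : T, [set mu; nu] (Y m w))
    (Y_nu : forall m : nat, (1 <= m)%N -> P (Y m @^-1` [set nu]) = p%:E)
    (gamma : R) (gamma_gtN1 : -1 < gamma) (gamma_lt1 : gamma < 1) :
  let Z := discounted_sum gamma Y in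
  (forall w : T,
     cvgn (fun n : nat => \sum_(1 <= m < n) gamma ^+ m * Y m w)) /\
  forall k : nat, (1 <= k)%N ->
    P.-integrable [set: T] (fun w => (Z w ^+ k)%:E) /\
    ('E_P[fun w => (Z w ^+ k)%R] =
      (gamma ^+ k / (1 - gamma ^+ k))%:E *
       \sum_(0 <= j < k)
         ('C(k, j)%:R * (p * nu ^+ (k - j) + (1 - p) * mu ^+ (k - j)))%:E *
         'E_P[fun w => (Z w ^+ j)%R])%E.
Proof.
have gamma_norm : `|gamma| < 1 by rewrite ltr_norml gamma_gtN1.
have [Y_indep _] := Y_iid; move=> Z; split=> [w|k k1].
  by apply/cvg_ex; eexists; exact: (cvg_discounted_partial Y_val gamma_norm).
have moment := discounted_sum_moment p_lt1 Y_indep Y_val Y_nu gamma_norm.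
(* All moments are finite, so the extended-real identity reduces to one between the reals [e j]. *)
have EZE j : ('E_P[fun w => (Z w ^+ j)%R] =
    (fine 'E_P[fun w => (Z w ^+ j)%R])%:E)%E.
  rewrite fineK// unlock; apply: integrable_fin_num => //.
  by case: (moment j).
set e := fun j => fine ('E_P[fun w => (Z w ^+ j)%R])%E.
split; first by case: (moment k).
pose c j := 'C(k, j)%:R * (p * nu ^+ (k - j) + (1 - p) * mu ^+ (k - j)).
have fixpoint : e k = gamma ^+ k * \sum_(j < k.+1) c j * e j.
  (* Both sides of [iter_mean_exp] converge, the left one along the shifted sequence; uniqueness of
     limits gives the equation. *)
  have [_ lhs] := moment k; rewrite -cvg_shiftS in lhs.
  apply: (cvg_unique _ lhs) => //.
  rewrite (_ : [sequence _]_n = (fun n => gamma ^+ k *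
      \sum_(j < k.+1) c j * iter_mean mu nu p gamma n (fun x => x ^+ j)));
      last first.
    by apply/funext => n; exact: iter_mean_exp.
  apply: cvgMl_tmp; apply: cvg_big => [|j _]; first exact: add_continuous.
  by apply: cvgMl_tmp; exact: (moment j).2.
have gk1 : 1 - gamma ^+ k != 0.
  rewrite subr_eq0 eq_sym lt_eqF//; apply: le_lt_trans (ler_norm _) _.
  by rewrite normrX exprn_ilt1// -lt0n.
rewrite EZE (eq_bigr (fun j => (c j * e j)%:E)); last first.
  by move=> j _; rewrite EZE -EFinM.
rewrite sumEFin -EFinM -/(e k) big_mkord; congr EFin.
(* The coefficient [c k] is [p + (1 - p) = 1], so the last summand is [e k] itself and moves to the
   left as [(1 - gamma ^+ k) * e k]. *)
move: fixpoint; rewrite big_ord_recr /= {2}/c subnn !expr0 binn !mulr1 mul1r.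
rewrite addrC (addrC p) subrK mul1r => fixpoint.
apply: (mulfI gk1); rewrite mulrA mulrCA divff// mulr1 mulrBl mul1r.
by rewrite {1}fixpoint; ring.
Qed.
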